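(* Let $G=L\ltimes U$ be an algebra group extension over $\mathbb{F}_q$, with $U=1+J$. Then the system of characters $\{\chi_\alpha:\ \alpha\in\mathcal{A}\}$ together with the system of subsets $\{K_\beta:\ \beta\in\mathcal{B}\}$ is a supercharacter theory of the group $G$.
   Context: **Supercharacter theory.** A supercharacter theory of a finite group $G$ is a pair $(\mathfrak{S},\mathcal{K})$, where $\mathfrak{S}=\{\chi_1,\dots,\chi_m\}$ is a system of pairwise orthogonal complex characters of $G$ and $\mathcal{K}=\{K_1,\dots,K_m\}$ is a partition of $G$ (the same number $m$ of characters and of classes), such that each $\chi_i$ is constant on each $K_j$ and $\{1\}\in\mathcal{K}$. **Algebra group extension.** Let $\mathbb{F}_q$ be a finite field and $J$ a finite-dimensional associative nilpotent $\mathbb{F}_q$-algebra; $U=1+J$ is the group with multiplication $(1+x)(1+y)=1+x+y+xy$. Let $L$ be a finite group with an $\mathbb{F}_q$-linear left action and an $\mathbb{F}_q$-linear right action on $J$ which commute with each other and satisfy $h(xy)=(hx)y$, $(xy)h=x(yh)$, $x(hy)=(xh)y$ for all $x,y\in J$, $h\in L$. Then $\mathrm{Ad}_h(1+x)=1+hxh^{-1}$ defines a homomorphism $\mathrm{Ad}:L\to\mathrm{Aut}(U)$, and $G=L\ltimes U$ is the corresponding semidirect product. Each element of $G$ is uniquely $g=h(1+x)$, $h\in L$, $x\in J$. The group $G$ acts on $J$ on the left and on the right: for $g=hu$ ($h\in L$, $u\in U$), $gx=h(ux)$ and $xg=(xh)u$, where $(1+y)x=x+yx$, $x(1+y)=x+xy$.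 On the dual space $J^*$, $G$ acts on the left by $(g\lambda)(x)=\lambda(xg)$ and on the right by $(\lambda g)(x)=\lambda(gx)$; for $h\in L$ put $\mathrm{Ad}^*_h(\lambda)=h\lambda h^{-1}$. ''$G\times G$ orbits'' in $J$ or $J^*$ are the sets $GxG$, $G\lambda G$. **Characters.** Fix a nontrivial character $t\mapsto\varepsilon^t$ of the additive group of $\mathbb{F}_q$ with values in $\mathbb{C}^*$. For $\lambda\in J^*$ let $J_{\lambda,\mathrm{right}}=\{y\in J:\ \lambda(yx)=0 \text{ for all } x\in J\}$ and $U_{\lambda,\mathrm{right}}=1+J_{\lambda,\mathrm{right}}$. Let $H_{G\lambda G}=\{h\in L:\ \mathrm{Ad}^*_h(\mu)=\mu \text{ for all }\mu\in G\lambda G\}$, a normal subgroup of $L$. For a normal subgroup $N$ of a group $S$, an $S$-irreducible character of $N$ is the sum of the distinct irreducible complex characters of $N$ in one $S$-conjugation orbit. Let $\mathcal{A}$ be the set of pairs $\alpha=(\theta,\lambda)$, where $\lambda$ runs through a set of representatives of the $G\times G$ orbits in $J^*$ and $\theta$ runs through the $L$-irreducible characters of $H_{G\lambda G}$. For $\alpha=(\theta,\lambda)\in\mathcal{A}$ put $H_0=H_{G\lambda G}$ and $G_{0,\lambda}=H_0\ltimes U_{\lambda,\mathrm{right}}$; for $p\in L$ the formula $\xi_{\theta,p\lambda}(h(1+x))=\theta(h)\varepsilon^{(p\lambda)(x)}$ ($h\in H_0$, $x\in J_{\lambda,\mathrm{right}}$) defines a character of $G_{0,\lambda}$, and $\chi_\alpha$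 is the character of $G$ induced from the character $\sum_{p\in L}\xi_{\theta,p\lambda}$ of $G_{0,\lambda}$. **Classes.** For $h\in L$, the sum of all linear spans $\langle G\lambda G\rangle$ over those $\lambda\in J^*$ with $h\in H_{G\lambda G}$ is the largest $G\times G$-invariant subspace of $J^*$ on which $\mathrm{Ad}^*_h$ acts as the identity; its orthogonal complement in $J$ is denoted $J_h$ (a two-sided ideal invariant under left and right multiplication by $L$). Let $\pi_h:J\to J/J_h$ be the natural projection. Let $\mathcal{B}$ be the set of pairs $\beta=(h,\omega)$, where $h$ runs through a set of representatives of the conjugacy classes of $L$ and $\omega$ runs through the $G\times G$ orbits in $J/J_h$. For $\beta=(h,\omega)$ put $K_\beta=\mathrm{Cl}_L(h)\cdot(1+\pi_h^{-1}(\omega))$, where $\mathrm{Cl}_L(h)$ is the conjugacy class of $h$ in $L$. *)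

(* Defs.v *)
From HB Require Import structures.
From mathcomp Require Import all_boot all_order all_fingroup all_algebra.
From mathcomp Require Import all_solvable all_field all_character.

Set Implicit Arguments.
Unset Strict Implicit.
Unset Printing Implicit Defensive.

Import GroupScope GRing.Theory VectorInternalTheory.
Local Open Scope ring_scope.

(* pairwise_orthogonal also asserts that no member of S is zero (the zero     *)
(* class function satisfies the library predicate `character'), hence that S  *)
(* has no repetitions; with uniq K, S and K enumerate a set of characters     *)
(* and a partition of the same cardinality.                                   *)
Definition supercharacter_theory (gT : finGroupType) (G : {group gT})
    (S : seq 'CF(G)) (K : seq {set gT}) : Prop :=
  [/\ {subset S <= character} /\ pairwise_orthogonal S,
      uniq K /\ partition [set:: K] G,
      size S = size K,
      {in S & K, forall (chi : 'CF(G)) (A : {set gT}),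
         {in A &, forall x y, chi x = chi y}}
    & [set 1%g] \in K].

(* The S-irreducible characters of N, for N normal in S: cfclass lists the    *)
(* distinct conjugates.                                                       *)
Definition relative_irr (gT : finGroupType) (S N : {group gT}) : seq 'CF(N) :=
  undup [seq \sum_(xi <- cfclass 'chi_i S) xi | i : Iirr N].

#[short(type="finVectType")]
HB.structure Definition FinVector (R : nzRingType) :=
  {V of Vector R V & Finite V}.

(* Every vectType over a finite field is a finVectType up to this alias.      *)
HB.instance Definition _ (F : finFieldType) (V : vectType F) :=
  Vector.on (finvect_type V).

Section FinHom.
Variables (F : finFieldType) (V W : vectType F).
HB.instance Definition _ := [Finite of 'Hom(V, W) by <:].
End FinHom.

Section LinearMap.
Variables (F : finFieldType) (V W : lmodType F) (f : V -> W).
Hypothesis f_lin : linear f.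
Let g : {linear V -> W} :=
  HB.pack f (GRing.isLinear.Build F V W _ f f_lin).
Lemma linmapD : {morph f : x y / x + y}. Proof. exact: (linearD g). Qed.
Lemma linmapN : {morph f : x / - x}. Proof. exact: (linearN g). Qed.
Lemma linmap0 : f 0 = 0. Proof. exact: (linear0 g). Qed.
End LinearMap.

Lemma linfunE_linear (F : finFieldType) (V W : vectType F) (f : V -> W) :
  linear f -> linfun f =1 f.
Proof.
move=> f_lin.
pose g : {linear V -> W} :=
  HB.pack f (GRing.isLinear.Build F V W _ f f_lin).
exact: (lfunE g).
Qed.

(* A finite-dimensional associative nilpotent F-algebra structure on J, with  *)
(* the two commuting linear actions of L compatible with the product.         *)
Record algGroupExt (F : finFieldType) (J : finVectType F) (L : finGroupType) :=
  AlgGroupExt {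
  jmul : J -> J -> J;
  jmul_linearl : forall y, linear (jmul^~ y);
  jmul_linearr : forall x, linear (jmul x);
  jmulA : associative jmul;
  (* J^(n+1) = 0 *)
  jmul_nilp : exists n, forall (x : J) (s : n.-tuple J), foldl jmul x s = 0;
  jlact : L -> J -> J;
  jract : J -> L -> J;
  jlact_linear : forall h, linear (jlact h);
  jract_linear : forall h, linear (jract^~ h);
  jlact1 : forall x, jlact 1%g x = x;
  jlactM : forall g h x, jlact (g * h)%g x = jlact g (jlact h x);
  jract1 : forall x, jract x 1%g = x;
  jractM : forall g h x, jract x (g * h)%g = jract (jract x g) h;
  jactC : forall g h x, jract (jlact g x) h = jlact g (jract x h);
  jlact_mul : forall h x y, jlact h (jmul x y) = jmul (jlact h x) y;
  jract_mul : forall h x y, jract (jmul x y) h = jmul x (jract y h);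
  jmul_mid : forall h x y, jmul x (jlact h y) = jmul (jract x h) y }.

(* The axioms force values in the nonzero elements of algC.                   *)
Record addChar (F : finFieldType) := AddChar {
  addchar :> F -> algC;
  addchar0 : addchar 0 = 1;
  addcharD : {morph addchar : s t / s + t >-> s * t} }.

Section AlgGroup.
Variables (F : finFieldType) (J : finVectType F) (L : finGroupType).
Variable E : algGroupExt J L.
Implicit Types (x y z : J) (h k p : L).
Local Notation "x ** y" := (jmul E x y) (at level 40, left associativity).
Local Notation "h *< x" := (jlact E h x) (at level 38, right associativity).
Local Notation "x >* h" := (jract E x h) (at level 39, left associativity).

Lemma jmulDl y : {morph jmul E ^~ y : x z / x + z}.
Proof. exact: linmapD (jmul_linearl E y). Qed.
Lemma jmulDr x : {morph jmul E x : y z / y + z}.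
Proof. exact: linmapD (jmul_linearr E x). Qed.
Lemma jmulNr x : {morph jmul E x : y / - y}.
Proof. exact: linmapN (jmul_linearr E x). Qed.
Lemma jmul0l x : 0 ** x = 0. Proof. exact: linmap0 (jmul_linearl E x). Qed.
Lemma jmul0r x : x ** 0 = 0. Proof. exact: linmap0 (jmul_linearr E x). Qed.
Lemma jlactD h : {morph jlact E h : x y / x + y}.
Proof. exact: linmapD (jlact_linear E h). Qed.
Lemma jlact0 h : h *< 0 = 0. Proof. exact: linmap0 (jlact_linear E h). Qed.
Lemma jractD h : {morph jract E ^~ h : x y / x + y}.
Proof. exact: linmapD (jract_linear E h). Qed.
Lemma jract0 h : 0 >* h = 0. Proof. exact: linmap0 (jract_linear E h). Qed.

(* U = 1 + J; the parameter E only serves to carry the product.               *)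
Record oneJ (E' : algGroupExt J L) : predArgType := OneJ { jpart : J }.
HB.instance Definition _ E' := [isNew for @jpart E'].
HB.instance Definition _ E' := [Finite of oneJ E' by <:].
Local Notation U := (oneJ E).
Implicit Types u v w : U.

Definition oneJ_one : U := OneJ E 0.
Definition oneJ_mul u v : U :=
  OneJ E (jpart u + jpart v + jpart u ** jpart v).

Lemma oneJ_mulA : associative oneJ_mul.
Proof.
move=> u v w; apply: val_inj => /=; rewrite !jmulDl !jmulDr jmulA.
by rewrite !addrA (ACl (1*2*5*3*6*4*7))%AC.
Qed.
Lemma oneJ_mul1 : left_id oneJ_one oneJ_mul.
Proof. by move=> u; apply: val_inj; rewrite /= jmul0l add0r addr0. Qed.
Lemma oneJ_mulr1 : right_id oneJ_one oneJ_mul.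
Proof. by move=> u; apply: val_inj; rewrite /= jmul0r !addr0. Qed.

Lemma oneJ_mulI u : injective (oneJ_mul u).
Proof.
set x := jpart u => v w /(congr1 val) /= /eqP; rewrite -!addrA => /eqP /addrI.
set y := jpart v; set z := jpart w => eq_yz; apply: val_inj; apply/eqP.
rewrite /= -subr_eq0; set d := _ - _.
have d_fix : d = - (x ** d).
  apply/eqP; rewrite -addr_eq0 /d jmulDr jmulNr addrACA -opprD subr_eq0.
  exact/eqP.
have dE n t : t ** d = (-1) ^+ n *: (foldl (jmul E) t (nseq n x) ** d).
  elim: n t => [|n IHn] t /=; first by rewrite scale1r.
  rewrite {1}d_fix jmulNr jmulA /= (IHn (t ** x)).
  by rewrite exprS mulN1r scaleNr.
have [n nilp] := jmul_nilp E; rewrite d_fix (dE n).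
have := nilp x (nseq_tuple n x); rewrite /= => ->.
by rewrite jmul0l scaler0 oppr0.
Qed.

Definition oneJ_inv u : U := invF (@oneJ_mulI u) oneJ_one.

Lemma oneJ_mulrV u : oneJ_mul u (oneJ_inv u) = oneJ_one.
Proof. exact: (f_invF (@oneJ_mulI u)). Qed.
Lemma oneJ_mulV : left_inverse oneJ_one oneJ_inv oneJ_mul.
Proof.
move=> u; have := oneJ_mulrV (oneJ_inv u).
suff -> : oneJ_inv (oneJ_inv u) = u by [].
by rewrite -[LHS]oneJ_mul1 -(oneJ_mulrV u) -oneJ_mulA oneJ_mulrV oneJ_mulr1.
Qed.
HB.instance Definition _ :=
  Finite_isGroup.Build U oneJ_mulA oneJ_mul1 oneJ_mulV.

(* sdprod_by takes a right action and multiplies pairs by                     *)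
(* (h, u) (k, v) = (h k, (u acted on by k) v), so that (h, u) stands for the  *)
(* product h u: h must act on the right by Ad_{h^-1}.                         *)
Definition oneJ_act u h : U := OneJ E ((h^-1)%g *< jpart u >* h).

Lemma oneJ_act1 : oneJ_act^~ 1%g =1 id.
Proof. by move=> u; apply: val_inj; rewrite /= invg1 jlact1 jract1. Qed.
Lemma oneJ_actM u : act_morph oneJ_act u.
Proof.
by move=> h k; apply: val_inj; rewrite /= invMg jlactM jractM !jactC.
Qed.
Definition oneJ_action := TotalAction oneJ_act1 oneJ_actM.
Lemma oneJ_actMl h : {morph oneJ_act ^~ h : u v / (u * v)%g}.
Proof.
move=> u v; apply: val_inj; rewrite /=.
rewrite !jlactD !jractD.
congr (_ + _); rewrite jlact_mul jract_mul (jactC E h^-1%g h (jpart v)).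
by rewrite jmul_mid -jractM mulgV jract1.
Qed.
Lemma oneJ_groupAction : is_groupAction [set: U] oneJ_action.
Proof.
move=> h _; rewrite inE; apply/andP; split.
  by apply/subsetP=> u; rewrite !inE.
by apply/morphicP=> u v _ _; rewrite !actpermE; apply: oneJ_actMl.
Qed.
Definition oneJ_gact := GroupAction oneJ_groupAction.

Definition semidirect : finGroupType := sdprod_by oneJ_gact.
Local Notation G := semidirect.
Implicit Types g : G.
(* The components of g = h (1 + x).                                           *)
Definition gpartL g : L := (pair_of_sd g).1.
Definition gpartJ g : J := jpart (pair_of_sd g).2.

Definition embL h : G := sdpair2 oneJ_gact h.

(* g x and x g for g = h (1 + y).                                             *)
Definition gactl g x : J := gpartL g *< (x + gpartJ g ** x).
Definition gactr x g : J := (x >* gpartL g) + (x >* gpartL g) ** gpartJ g.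

Definition dual := 'Hom(J, F^o).
Implicit Types lam mu : dual.

Definition dactl g lam : dual := linfun (fun x => lam (gactr x g) : F^o).
Definition dactr lam g : dual := linfun (fun x => lam (gactl g x) : F^o).

Lemma dactlE g lam x : dactl g lam x = lam (gactr x g).
Proof.
rewrite /dactl linfunE_linear // => a y z.
by rewrite /gactr jract_linear jmul_linearl addrACA -scalerDr linearP.
Qed.
Lemma dactrE g lam x : dactr lam g x = lam (gactl g x).
Proof.
rewrite /dactr linfunE_linear // => a y z.
by rewrite /gactl jmul_linearr addrACA -scalerDr jlact_linear linearP.
Qed.

Definition dorbit lam : {set dual} :=
  [set dactr (dactl g.1 lam) g.2 | g : G * G].

Definition coad h lam : dual := dactr (dactl (embL h) lam) (embL h^-1).

Lemma embL_val h : pair_of_sd (embL h) = (h, 1%g).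
Proof. by rewrite -[LHS]/(val (embL h)) val_insubd !inE. Qed.
Lemma embL_L h : gpartL (embL h) = h.
Proof. by rewrite /gpartL embL_val. Qed.
Lemma embL_J h : gpartJ (embL h) = 0.
Proof. by rewrite /gpartJ embL_val. Qed.
Lemma gactl_embL h x : gactl (embL h) x = h *< x.
Proof. by rewrite /gactl embL_L embL_J jmul0l addr0. Qed.
Lemma gactr_embL h x : gactr x (embL h) = x >* h.
Proof. by rewrite /gactr embL_L embL_J jmul0r addr0. Qed.
Lemma coadE h lam x : coad h lam x = lam (h^-1%g *< x >* h).
Proof. by rewrite dactrE dactlE gactr_embL gactl_embL. Qed.

(* H_{G lam G} *)
Definition dstab_set lam : {set L} :=
  [set h | [forall mu in dorbit lam, coad h mu == mu]].

Lemma dstabP lam h :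
  reflect {in dorbit lam, forall mu, coad h mu = mu} (h \in dstab_set lam).
Proof. by rewrite inE; apply: (iffP eqfun_inP). Qed.

Lemma dstab_group_set lam : group_set (dstab_set lam).
Proof.
apply/group_setP; split=> [|h k /dstabP cH /dstabP cK]; apply/dstabP=> mu mu_o.
  by apply/lfunP=> x; rewrite coadE invg1 jlact1 jract1.
apply/lfunP=> x; rewrite -[in RHS](cH mu mu_o) -[in RHS](cK mu mu_o).
by rewrite !coadE invMg jlactM jractM !jactC.
Qed.
Canonical dstab lam := Group (dstab_group_set lam).

Definition Jright lam : {set J} := [set y | [forall x, lam (y ** x) == 0]].

Lemma JrightP lam y : reflect (forall x, lam (y ** x) = 0) (y \in Jright lam).
Proof. by rewrite inE; apply: (iffP forallP) => Jy x; apply/eqP. Qed.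

(* G_{0,lam} = H_{G lam G} U_{lam,right}                                      *)
Definition G0_set lam : {set G} :=
  [set g | (gpartL g \in dstab lam) && (gpartJ g \in Jright lam)].

Lemma gpartLM : {morph gpartL : g g' / (g * g')%g}. Proof. by []. Qed.
Lemma gpartJM g g' (x := (gpartL g')^-1%g *< gpartJ g >* gpartL g') :
  gpartJ (g * g')%g = x + gpartJ g' + x ** gpartJ g'.
Proof. by []. Qed.

Lemma gactl1 x : gactl 1%g x = x.
Proof. by rewrite /gactl jmul0l addr0 jlact1. Qed.
Lemma gactr1 x : gactr x 1%g = x.
Proof. by rewrite /gactr jmul0r addr0 jract1. Qed.
Lemma dactl_dorbit p lam : dactl (embL p) lam \in dorbit lam.
Proof.
apply/imsetP; exists (embL p, 1%g) => //=.
by apply/lfunP=> x; rewrite dactrE gactl1.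
Qed.
Lemma dorbit_refl lam : lam \in dorbit lam.
Proof.
apply/imsetP; exists (1%g, 1%g) => //=.
by apply/lfunP=> x; rewrite dactrE dactlE gactl1 gactr1.
Qed.

Lemma Jright_conj lam h x : h \in dstab lam -> x \in Jright lam ->
  h^-1%g *< x >* h \in Jright lam.
Proof.
move=> /dstabP/(_ _ (dorbit_refl lam)) lam_h /JrightP Jx; apply/JrightP=> z.
have lamV z0 : lam (h^-1%g *< z0) = lam (z0 >* h^-1%g).
  by rewrite -[in RHS]lam_h coadE jactC -jractM mulVg jract1.
by rewrite jactC -jlact_mul -jmul_mid lamV jract_mul Jx.
Qed.

Lemma G0P lam g :
  reflect (gpartL g \in dstab lam /\ gpartJ g \in Jright lam) (g \in G0_set lam).
Proof. by rewrite [_ \in G0_set _]inE; apply: andP. Qed.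

Lemma G0_group_set lam : group_set (G0_set lam).
Proof.
apply/group_setP; split=> [|g g' /G0P[Hg Jg] /G0P[Hg' /JrightP Jg']]; apply/G0P.
  by split; [apply: group1 | apply/JrightP=> x; rewrite jmul0l linear0].
split; first by rewrite gpartLM groupM.
have /JrightP Jx := Jright_conj Hg' Jg.
apply/JrightP=> z; rewrite gpartJM !jmulDl !linearD /= Jx Jg' -jmulA Jx.
by rewrite !addr0.
Qed.
Canonical G0 lam := Group (G0_group_set lam).

Variable eps : addChar F.

(* xi_{theta, p lam}, extended by 0 outside G_{0,lam}, as required by 'CF     *)
Definition xi_fun lam (theta : 'CF(dstab lam)) p g : algC :=
  if g \in G0 lam
  then theta (gpartL g) * eps (dactl (embL p) lam (gpartJ g)) else 0.

Lemma xi_subproof lam theta p :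
  is_class_fun <<G0 lam>> (finfun (@xi_fun lam theta p)).
Proof.
rewrite genGid; apply: intro_class_fun => [g k Gg Gk | g /negPf Gg]; last first.
  by rewrite /xi_fun Gg.
rewrite /xi_fun groupJ // Gg.
have [[Hg Jg] [Hk Jk]] := (G0P _ _ Gg, G0P _ _ Gk).
have -> : gpartL (g ^ k)%g = (gpartL g ^ gpartL k)%g by [].
rewrite cfunJ //; congr (_ * _).
pose mu := dactl (embL p) lam; rewrite -/mu.
pose psi (x : G) := eps (mu (gpartJ x)).
have psiM : {in G0 lam &, {morph psi : x y / (x * y)%g >-> x * y}}.
  move=> x y /G0P[Hx Jx] /G0P[Hy Jy]; rewrite /psi gpartJM -addcharD.
  rewrite !linearD /=; congr (eps _).
  have /JrightP Jz := Jright_conj Hy Jx.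
  have /dstabP/(_ _ (dactl_dorbit p lam)) muy := Hy.
  rewrite -coadE muy [X in _ + _ + X](_ : _ = 0) ?addr0 //.
  by rewrite dactlE gactr_embL jract_mul Jz.
have psik0 : psi k != 0.
  apply/eqP=> psi0; have := psiM k k^-1%g Gk (groupVr Gk).
  rewrite mulgV psi0 mul0r /psi -[gpartJ _]/(0 : J) linear0 addchar0.
  by apply/eqP; apply: oner_neq0.
apply: (mulfI psik0); rewrite -!/(psi _) -psiM ?groupJ // -conjgC.
by rewrite psiM // mulrC.
Qed.
Definition xi lam theta p : 'CF(G0 lam) := Cfun 0 (@xi_subproof lam theta p).

Lemma xiE lam theta p g : g \in G0 lam ->
  @xi lam theta p g = theta (gpartL g) * eps (dactl (embL p) lam (gpartJ g)).
Proof. by move=> Gg; rewrite cfunE /xi_fun Gg. Qed.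

(* Pairs (theta, lam) are encoded with lam first, since theta depends on it.  *)
Definition calA (Lam : {set dual}) : seq {lam : dual & 'CF(dstab lam)} :=
  [seq Tagged (fun lam => 'CF(dstab lam)) theta
     | lam <- enum Lam, theta <- relative_irr [set: L]%G (dstab lam)].

Definition chi (alpha : {lam : dual & 'CF(dstab lam)}) : 'CF([set: G]) :=
  'Ind[[set: G], G0 (tag alpha)] (\sum_(p : L) xi (tagged alpha) p).

(* The largest G x G-invariant subspace of J^* fixed pointwise by Ad^*_h      *)
Definition fixdual h : {vspace dual} :=
  (\sum_(lam : dual | h \in dstab lam) <<enum (dorbit lam)>>)%VS.

(* J_h, the common kernel of the functionals in fixdual h                     *)
Definition Jperp h : {vspace J} := (\bigcap_(mu in fixdual h) lker mu)%VS.

(* J / J_h is the set of cosets of J_h, and piJ h the natural projection.     *)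
Definition piJ h x : {set J} := [set y | y - x \in Jperp h].
Definition quoJ h : {set {set J}} := [set piJ h x | x : J].

Definition qorbit (c : {set J}) : {set {set J}} :=
  [set [set gactr (gactl g.1 x) g.2 | x in c] | g : G * G].

Definition calB (R : {set L}) : {set L * {set {set J}}} :=
  [set beta | (beta.1 \in R) && (beta.2 \in [set qorbit c | c in quoJ beta.1])].

Definition Kset (beta : L * {set {set J}}) : {set G} :=
  ([set embL h | h in beta.1 ^: [set: L]] *
   [set sdpair1 oneJ_gact (OneJ E x) | x in piJ beta.1 @^-1: beta.2])%g.

End AlgGroup.

(* Main.v *)
Require Import Defs.
From HB Require Import structures.
From mathcomp Require Import all_boot all_order all_fingroup all_algebra.
From mathcomp Require Import all_solvable all_field all_character.

Set Implicit Arguments.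
Unset Strict Implicit.
Unset Printing Implicit Defensive.

Import GroupScope GRing.Theory Num.Theory.
Local Open Scope ring_scope.

(** Everything rests on one formula ([chiE]).  For alpha = (theta, lam) and
    H = H_(G lam G), extending theta by 0 outside H,
<<
      chi_alpha (h (1 + x)) = c * theta h * S_lam x,
      S_lam x = sum over a, b in G of eps (lam (a x b)),
>>
    with a constant c > 0 that depends on lam only.  Two facts give it.  The
    indicator of J_(lam,right) is an average of additive characters of J, and
    that average completes the sum over p in L of the xi_(theta, p lam) to a sum
    over the left orbit G lam ([xi_sumE]).  And if h is in H, then conjugating
    h (1 + x) by k in G replaces x by k^-1 x k up to an element killed by all of
    G lam G ([biact_conj]), so that inducing completes the left orbit to the
    orbit G lam G.

    In the formula the variables h and x are separated.  The factor theta is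
    L-invariant, and S_lam is G x G-invariant and J_h-periodic if h is in H:
    hence chi_alpha is constant on superclasses ([chi_superclass]).  The
    scalar product of two such characters is a product of a scalar product of
    L-irreducible characters and one of orbit sums, and distinct orbits involve
    distinct additive characters of J: hence orthogonality ([chi_orthogonal]).

    That there are as many characters as superclasses follows by showing that
    the table chi_i (K_j) has independent rows, by orthogonality, and
    independent columns ([size_complete]).  The latter says that a function f
    which is constant on superclasses and orthogonal to all the chi_alpha is 0
    ([superclass_function_eq0]).  Consider the Fourier transform of
    x |-> f (h (1 + x)) at mu.  If h is not in H_(G mu G), it vanishes because
    f is J_h-periodic and mu is not trivial on J_h; that mu is not trivial is
    the double annihilator theorem for finite vector spaces, J_h being the
    annihilator of the set of all mu with h in H_(G mu G).  If h is in
    H_(G mu G), it vanishes because, as a function of h, it is L-invariant on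
    H_(G mu G) and orthogonal to all the L-irreducible characters of this group.
    Fourier inversion on J then gives f = 0. *)

(** * Relative irreducible characters *)

Section RelativeIrr.
Variables (gT : finGroupType) (S N : {group gT}).
Hypothesis nNS : N <| S.

Lemma relative_irrP theta :
  reflect (exists i, theta = \sum_(j | 'chi_j \in cfclass 'chi_i S) 'chi_j)
          (theta \in relative_irr S N).
Proof.
rewrite mem_undup; apply: (iffP mapP) => [[i _ ->] | [i ->]].
  by exists i; rewrite (reindex_cfclass _ id).
by exists i; rewrite ?mem_enum // (reindex_cfclass _ id).
Qed.

Lemma relative_irr_char theta :
  theta \in relative_irr S N -> theta \is a character.
Proof.
by case/relative_irrP=> i ->; apply: rpred_sum => j _; apply: irr_char.
Qed.

Lemma relative_irr1_neq0 theta : theta \in relative_irr S N -> theta 1%g != 0.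
Proof.
move=> theta_S; rewrite char1_eq0 ?relative_irr_char //.
have [i ->] := relative_irrP _ theta_S; apply/eqP=> theta0.
have /eqP := congr1 (cfdotr 'chi_i) theta0.
rewrite /= cfdot0l cfdot_suml (bigD1 i) ?cfclass_refl //= cfnorm_irr.
rewrite big1 ?addr0 ?oner_eq0 // => j /andP[_ /negPf neq_ji].
by rewrite cfdot_irr neq_ji.
Qed.

(** Conjugation by an element of S permutes the class that is summed. *)
Lemma relative_irrJ theta y x :
  theta \in relative_irr S N -> y \in S -> theta (x ^ y)%g = theta x.
Proof.
move=> /relative_irrP[i ->] Sy; have nNy := subsetP (normal_norm nNS) y Sy.
rewrite -(reindex_cfclass _ id) // -[RHS](cfConjgEJ _ _ nNy) raddf_sum /=.
congr (fun_of_cfun _ _); rewrite -(big_map (cfConjg y) xpredT id) /=.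
have inj_y : injective (cfConjg y : 'CF(N) -> _) by apply: can_inj (cfConjgK y).
apply/perm_big/uniq_perm; rewrite ?(map_inj_uniq inj_y) ?cfclass_uniq //.
move=> phi; apply/idP/mapP => [/cfclassP[z Sz ->] | [_ /cfclassP[z Sz ->] ->]].
  exists ('chi_i ^ (z * y^-1))%CF; last first.
    by rewrite -(cfConjgM _ nNS) ?groupM ?groupV ?mulgKV.
  by apply/cfclassP; exists (z * y^-1)%g; rewrite ?groupM ?groupV.
by apply/cfclassP; exists (z * y)%g; rewrite ?groupM // (cfConjgM _ nNS).
Qed.

Lemma relative_irr_orthogonal :
  {in relative_irr S N &, forall theta eta, theta != eta -> '[theta, eta] = 0}.
Proof.
move=> _ _ /relative_irrP[i ->] /relative_irrP[j ->]; apply: contraNeq.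
move=> ij_neq0; apply/eqP/eq_bigl.
have [k ik jk] :
    exists2 k, 'chi_k \in cfclass 'chi_i S & 'chi_k \in cfclass 'chi_j S.
  apply/exists_inP; apply: contraNT ij_neq0 => /exists_inPn ij.
  rewrite cfdot_suml big1 // => k ik; rewrite cfdot_sumr big1 // => l jl.
  rewrite cfdot_irr; case: eqP => // kl; have := ij _ ik.
  by rewrite kl jl.
by move=> k'; rewrite (cfclass_transr ik) (cfclass_transr jk).
Qed.

(** A scalar product of an S-invariant function with an S-class sum is a
    multiple of its scalar product with any single character of the class, so
    that all its coordinates on the irreducible characters vanish. *)
Lemma relative_irr_complete (f : gT -> algC) :
    {in S & N, forall y x, f (x ^ y)%g = f x} ->
    {in relative_irr S N, forall theta : 'CF(N),
       \sum_(x in N) f x * (theta x)^* = 0} ->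
  {in N, forall x, f x = 0}.
Proof.
move=> fJ f0; have sNS := subsetP (normal_sub nNS).
pose phi_fun := [ffun x => if x \in N then f x else 0].
have phiP : is_class_fun <<N>> phi_fun.
  rewrite genGid; apply: intro_class_fun => [x y Nx Ny | x /negPf-> //].
  by rewrite groupJ // Nx fJ // sNS.
pose phi : 'CF(N) := Cfun 0 phiP.
have phiE : {in N, phi =1 f} by move=> x Nx; rewrite cfunE Nx.
suff phi0 : phi = 0 by move=> x Nx; rewrite -phiE // phi0 cfunE.
rewrite [phi]cfun_sum_cfdot big1 // => i _.
suff -> : '[phi, 'chi_i] = 0 by rewrite scale0r.
pose theta : 'CF(N) := \sum_(j | 'chi_j \in cfclass 'chi_i S) 'chi_j.
have f0i : \sum_(x in N) f x * (theta x)^* = 0.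
  by apply: f0; apply/relative_irrP; exists i.
have : '[phi, theta] = 0.
  rewrite cfdotE (eq_bigr (fun x => f x * (theta x)^*)) => [|x Nx].
    by rewrite f0i mulr0.
  by rewrite phiE.
rewrite cfdot_sumr (eq_bigr (fun=> '[phi, 'chi_i])) => [|j].
  rewrite sumr_const -mulr_natl => /eqP; rewrite mulf_eq0 pnatr_eq0.
  case/orP=> [/eqP/card0_eq/(_ i) | /eqP//].
  by move/(etrans (esym (cfclass_refl S 'chi_i))).
case/cfclassP=> y Sy ->; have nNy := subsetP (normal_norm nNS) y Sy.
rewrite -[RHS](cfConjg_iso y); congr '[_, _]; apply/cfun_inP=> x Nx.
by rewrite cfConjgE // !phiE ?memJ_norm ?groupV // fJ ?groupV.
Qed.

End RelativeIrr.

(** * A square character table *)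

Section Counting.
Variables (gT : finGroupType) (G : {group gT}).
Variables (S : seq 'CF(G)) (K : seq {set gT}).
Hypothesis oS : pairwise_orthogonal S.
Hypotheses (uK : uniq K) (partK : partition [set:: K] G).
Hypothesis SK : {in S & K, forall (chi : 'CF(G)) (A : {set gT}),
   {in A &, forall x y, chi x = chi y}}.
Hypothesis S_complete : forall f : gT -> algC,
  {in K, forall A : {set gT}, {in A &, forall x y, f x = f y}} ->
  {in S, forall chi : 'CF(G), \sum_(g in G) f g * (chi g)^* = 0} ->
  {in G, forall g, f g = 0}.

Let K_nonempty A : A \in K -> repr A \in A.
Proof.
move=> KA; have [A0|[x Ax]] := set_0Vmem A; last exact: mem_repr Ax.
by case/and3P: partK => _ _; rewrite inE -A0 KA.
Qed.

Let K_sub A : A \in K -> A \subset G.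
Proof.
by case/and3P: partK => /eqP <- _ _ KA; apply: bigcup_sup; rewrite inE.
Qed.

Let KN (i : 'I_(size K)) : nth set0 K i \in K. Proof. exact: mem_nth. Qed.

Let mem_K (i j : 'I_(size K)) g :
  g \in nth set0 K i -> (g \in nth set0 K j) = (j == i).
Proof.
case/and3P: partK => _ /trivIsetP tiK _ gi.
rewrite -val_eqE /= -(nth_uniq set0 (ltn_ord j) (ltn_ord i) uK).
apply/idP/eqP=> [gj | -> //]; apply/eqP/negPn/negP=> /tiK.
by rewrite !inE !KN => /(_ isT isT)/disjointFr/(_ gj); rewrite gi.
Qed.

(** The matrix of values on representatives of the blocks of K has independent
    rows because orthogonal class functions are independent, and independent
    columns because of the completeness of S. *)
Lemma size_complete : size S = size K.
Proof.
pose A j := nth set0 K j; pose r (j : 'I_(size K)) := repr (A j).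
have rA (j : 'I_(size K)) : r j \in A j by apply: K_nonempty.
have SA (i : 'I_(size S)) (j : 'I_(size K)) g :
    g \in A j -> S`_i g = S`_i (r j).
  by move=> gj; apply: (SK (mem_nth _ (ltn_ord i)) (KN j)).
have rank_free m n (M : 'M[algC]_(m, n)) : row_free M -> (m <= n)%N.
  by move=> /eqP <-; apply: rank_leq_col.
apply/eqP; rewrite eqn_leq; apply/andP; split.
  apply: (rank_free _ _ (\matrix_(i, j) S`_i (r j))).
  apply: inj_row_free => v vM; apply/rowP=> i; rewrite mxE.
  have /freeP : free (in_tuple S) by apply: orthogonal_free.
  apply.
  apply/cfun_inP=> g Gg; rewrite sum_cfunE cfunE.
  have /bigcupP[B] : g \in cover [set:: K] by case/and3P: partK => /eqP->.
  rewrite inE => KB Bg; have [j ltj Bj] := nthP set0 KB.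
  pose jo := Ordinal ltj; have gj : g \in A jo by rewrite /A Bj.
  have := congr1 (fun w : 'rV_(size K) => w 0 jo) vM.
  rewrite !mxE; apply: etrans.
  by apply: eq_bigr => k _; rewrite cfunE mxE (SA _ _ _ gj).
apply: (rank_free _ _ (\matrix_(j, i) (S`_i (r j))^*)).
apply: inj_row_free => w wM.
(* The weights 1 / #|A j| turn the sum over g in G of f g * (chi g)^* into the
   row w times the column of conjugate values of chi on the blocks. *)
pose f g := \sum_(j : 'I_(size K)) (g \in A j)%:R * (w 0 j / #|A j|%:R).
have fA (j : 'I_(size K)) g : g \in A j -> f g = w 0 j / #|A j|%:R.
  move=> gj; rewrite /f (bigD1 j) //= gj mul1r big1 ?addr0 // => k /negPf nkj.
  by rewrite (mem_K _ gj) nkj mul0r.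
have f0 : {in G, forall g, f g = 0}.
  apply: S_complete => [B /(nthP set0)[j ltj <-] x y xj yj
                       | c /(nthP 0)[i lti <-]].
    by rewrite !(fA (Ordinal ltj)).
  have := congr1 (fun v : 'rV_(size S) => v 0 (Ordinal lti)) wM.
  rewrite !mxE; apply: etrans.
  under eq_bigr do rewrite mulr_suml.
  rewrite exchange_big; apply: eq_bigr => j _ /=.
  rewrite mxE (bigID (fun g => g \in A j)) /= addrC.
  rewrite big1 ?add0r => [|g /andP[_ /negPf->]]; last by rewrite !mul0r.
  rewrite (eq_bigl (fun g => g \in A j)) => [|g]; last first.
    by rewrite andb_idl //; apply/subsetP/K_sub/KN.
  have term g : g \in A j ->
      (g \in A j)%:R * (w 0 j / #|A j|%:R) * (S`_i g)^*
        = w 0 j / #|A j|%:R * (S`_i (r j))^*.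
    by move=> gj; rewrite gj mul1r -(SA (Ordinal lti) j g gj).
  rewrite (eq_bigr _ term).
  rewrite sumr_const -[LHS]mulr_natl mulrA; congr (_ * _).
  rewrite mulrC divfK //.
  by rewrite pnatr_eq0 -lt0n; apply/card_gt0P; exists (r j).
apply/rowP=> j; rewrite mxE.
have /eqP := f0 (r j) (subsetP (K_sub (KN j)) _ (rA j)).
rewrite (fA j) // mulf_eq0 invr_eq0 pnatr_eq0 => /orP[/eqP// | /eqP/card0_eq].
by move/(_ (r j)); rewrite rA.
Qed.

End Counting.

(** * Fourier analysis on a finite vector space *)

Section AddChar.
Variables (F : finFieldType) (eps : addChar F).

Lemma addchar_neq0 t : eps t != 0.
Proof.
apply/eqP=> t0; have := addcharD eps t (- t).
by rewrite subrr addchar0 t0 mul0r => /eqP; rewrite oner_eq0.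
Qed.

Lemma addcharN t : eps (- t) = (eps t)^-1.
Proof.
apply: (mulfI (addchar_neq0 t)).
by rewrite -addcharD subrr addchar0 mulfV ?addchar_neq0.
Qed.

Lemma addcharMn t n : eps (t *+ n) = eps t ^+ n.
Proof.
by elim: n => [|n IHn]; rewrite ?addchar0 // mulrS exprS addcharD IHn.
Qed.

(** F has positive characteristic p, so that the values of eps are p-th roots
    of unity. *)
Lemma conj_addchar t : (eps t)^* = eps (- t).
Proof.
have [p p_pr pF] := finPcharP F.
have norm1 : `|eps t| = 1.
  apply/eqP; rewrite -(@pexpr_eq1 _ _ p) ?prime_gt0 // -normrX -addcharMn.
  by rewrite (mulrn_pchar pF) addchar0 normr1.
by rewrite addcharN invC_norm norm1 expr1n invr1 mul1r.
Qed.

Hypothesis eps_nontrivial : exists t, eps t != 1.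

(** If f is not 0 on U, some w1 in U has eps (f w1) != 1, and translation by w1
    multiplies the sum by eps (f w1). *)
Lemma sum_addchar_linear (W : finVectType F) (U : {vspace W}) (f : W -> F) :
    (forall c, {morph f : u v / c *: u + v >-> c * u + v}) ->
  \sum_(w in U) eps (f w)
    = if [forall w in U, f w == 0] then #|[pred w in U]|%:R else 0.
Proof.
move=> f_lin; case: ifPn => [/forall_inP f0 | /forall_inPn[w0 Uw0 fw0]].
  rewrite (eq_bigr (fun=> 1)) => [|w /f0/eqP->]; last exact: addchar0.
  by rewrite sumr_const.
have [t neq1] := eps_nontrivial; set S := \sum_(w in U) _.
pose w1 := (t / f w0) *: w0.
have fw1 w : f (w1 + w) = t + f w by rewrite f_lin divfK.
have : S = eps t * S.
  rewrite {1}/S (reindex_inj (addrI w1)) /= mulr_sumr.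
  apply: eq_big => w; last by rewrite fw1 addcharD.
  by rewrite rpredDl // memvZ.
move/eqP; rewrite eq_sym -subr_eq0 -[X in _ - X]mul1r -mulrBl mulf_eq0 subr_eq0.
by rewrite (negPf neq1) => /eqP.
Qed.

Section Duality.
Variable J : finVectType F.
Implicit Types (lam mu : dual J) (x : J).

Lemma sum_addchar (f : J -> F) :
    (forall c, {morph f : u v / c *: u + v >-> c * u + v}) ->
  \sum_x eps (f x) = if [forall x, f x == 0] then #|J|%:R else 0.
Proof.
move=> f_lin; have := sum_addchar_linear fullv f_lin.
rewrite (eq_bigl predT) => [->|x]; last exact: memvf.
congr (if _ then _ else _).
  by apply: eq_forallb => x; rewrite memvf.
by congr (_%:R); apply: eq_card => x; rewrite !inE memvf.
Qed.

Lemma sum_addchar_dual lam :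
  \sum_x eps (lam x) = if lam == 0 then #|J|%:R else 0.
Proof.
rewrite (@sum_addchar lam) => [|c u v]; last by rewrite linearP.
congr (if _ then _ else _); apply/forallP/eqP=> [lam0 | -> x].
  by apply/lfunP=> x; rewrite zero_lfunE; apply/eqP.
by rewrite zero_lfunE.
Qed.

Lemma sum_addchar_eval (V : {vspace dual J}) x :
  \sum_(mu in V) eps (mu x) =
    if [forall mu in V, mu x == 0] then #|[pred mu in V]|%:R else 0.
Proof.
by rewrite (@sum_addchar_linear _ V (fun mu => mu x)) // => c u v;
  rewrite add_lfunE scale_lfunE.
Qed.

(** If lam vanishes on the annihilator Z of V but is not in V, the double sum of
    eps (mu x - lam x) over x in J and mu in V is 0 when summed over x first,
    and #|Z| * #|V| when summed over mu first. *)
Lemma mem_double_annihilator (V : {vspace dual J}) lam :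
  (forall x, (forall mu, mu \in V -> mu x = 0) -> lam x = 0) -> lam \in V.
Proof.
move=> lamV; apply/negPn/negP=> V'lam.
pose Z := [set x | [forall mu in V, mu x == 0]].
have : \sum_x eps (- lam x) * \sum_(mu in V) eps (mu x) = 0.
  under eq_bigr do rewrite mulr_sumr.
  rewrite exchange_big big1 //= => mu Vmu.
  rewrite (eq_bigr (fun x => eps ((mu - lam) x))) => [|x _]; last first.
    by rewrite add_lfunE opp_lfunE addrC addcharD.
  rewrite sum_addchar_dual subr_eq0; case: eqP => // mu_lam.
  by rewrite -mu_lam Vmu in V'lam.
suff -> : \sum_x eps (- lam x) * \sum_(mu in V) eps (mu x)
     = #|Z|%:R * #|[pred mu in V]|%:R.
  move/eqP; rewrite mulf_eq0 !pnatr_eq0 => /orP[] /eqP/card0_eq/(_ 0).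
    rewrite !inE => /negP[]; apply/forall_inP=> mu _; by rewrite linear0.
  by rewrite !inE mem0v.
rewrite mulr_natl -sumr_const [RHS]big_mkcond; apply: eq_bigr => x _.
rewrite sum_addchar_eval inE; case: ifP => [/forall_inP Vx | _].
  rewrite lamV ?oppr0 ?addchar0 ?mul1r // => mu /Vx; exact/eqP.
by rewrite mulr0.
Qed.

Lemma dual_separates x : (forall mu : dual J, mu x = 0) -> x = 0.
Proof.
move=> x0; rewrite (coord_vbasis (memvf x)) big1 // => i _.
have := x0 (linfun (coord (vbasis {:J}) i : J -> F^o)).
by rewrite lfunE /= => ->; rewrite scale0r.
Qed.

Lemma sum_addchar_point x :
  \sum_(mu : dual J) eps (mu x) = if x == 0 then #|{: dual J}|%:R else 0.
Proof.
have := sum_addchar_eval (@fullv F (dual J)) x.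
rewrite (eq_bigl predT) => [->|mu]; last exact: memvf.
congr (if _ then _ else _); last first.
  by congr (_%:R); apply: eq_card => mu; rewrite !inE memvf.
apply/forall_inP/eqP => [x0 | -> mu _]; last by rewrite linear0.
rewrite (coord_vbasis (memvf x)) big1 // => i _.
have /x0/eqP : linfun (coord (vbasis {:J}) i : J -> F^o) \in fullv.
  exact: memvf.
by rewrite lfunE /= => ->; rewrite scale0r.
Qed.

Lemma fourier_inj (f : J -> algC) :
  (forall mu : dual J, \sum_x f x * eps (- mu x) = 0) -> f =1 fun=> 0.
Proof.
move=> f0 y.
have : \sum_(mu : dual J) eps (mu y) * \sum_x f x * eps (- mu x) = 0.
  by apply: big1 => mu _; rewrite f0 mulr0.
under eq_bigr do rewrite mulr_sumr.
rewrite exchange_big /=.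
have eqf (x : J) : \sum_(mu : dual J) eps (mu y) * (f x * eps (- mu x))
    = f x * (if y == x then #|{: dual J}|%:R else 0).
  rewrite -subr_eq0 -sum_addchar_point mulr_sumr; apply: eq_bigr => mu _.
  by rewrite linearB addcharD mulrCA.
under eq_bigr do rewrite eqf.
rewrite (bigD1 y) //= eqxx big1 => [|x /negPf]; last first.
  by rewrite eq_sym => ->; rewrite mulr0.
move/eqP; rewrite addr0 mulf_eq0 pnatr_eq0 => /orP[/eqP-> // | /eqP].
by move/card0_eq/(_ 0).
Qed.

End Duality.
End AddChar.

(** * The two actions of G on J *)

Section Bimodule.
Variables (F : finFieldType) (J : finVectType F) (L : finGroupType).
Variable E : algGroupExt J L.
Local Notation G := (semidirect E).
Implicit Types (x y z : J) (h : L) (a b g k : G) (lam mu : dual J).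

(** The element h (1 + x) of G. *)
Definition sdpoint h x : G :=
  (embL E h * sdpair1 (oneJ_gact E) (OneJ E x))%g.

Lemma gpartL_sdpoint h x : gpartL (sdpoint h x) = h.
Proof.
rewrite /sdpoint gpartLM embL_L /gpartL -[pair_of_sd _]/(val _) val_insubd.
by rewrite !inE mulg1.
Qed.

Lemma gpartJ_sdpoint h x : gpartJ (sdpoint h x) = x.
Proof.
rewrite /sdpoint gpartJM embL_J jlact0 jract0 jmul0l add0r addr0.
by rewrite /gpartJ -[pair_of_sd _]/(val _) val_insubd !inE.
Qed.

Lemma sdpointK g : sdpoint (gpartL g) (gpartJ g) = g.
Proof. by rewrite [RHS]sdpairE /sdpoint /gpartJ; case: (pair_of_sd g).2. Qed.

Lemma sdpoint_bij : bijective (fun hx : L * J => sdpoint hx.1 hx.2).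
Proof.
exists (fun g => (gpartL g, gpartJ g)) => [[h x]|g] /=; last exact: sdpointK.
by rewrite gpartL_sdpoint gpartJ_sdpoint.
Qed.

Lemma sum_semidirect (R : nmodType) (f : L -> J -> R) :
  \sum_(g : G) f (gpartL g) (gpartJ g) = \sum_(h : L) \sum_(x : J) f h x.
Proof.
rewrite pair_big (reindex _ (onW_bij _ sdpoint_bij)) /=.
by apply: eq_bigr => [[h x]] _; rewrite gpartL_sdpoint gpartJ_sdpoint.
Qed.

Lemma gactl_linear g : linear (gactl g : J -> J).
Proof.
by move=> c x y; rewrite /gactl jmul_linearr addrACA -scalerDr jlact_linear.
Qed.

Lemma gactr_linear g : linear (fun x => gactr x g : J).
Proof.
by move=> c x y; rewrite /gactr jract_linear jmul_linearl addrACA -scalerDr.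
Qed.

Lemma jlact_conjM h z y :
  jlact E h (jmul E (jract E (jlact E h^-1%g z) h) y) = jmul E z (jlact E h y).
Proof. by rewrite jactC -jlact_mul -jlactM mulgV jlact1 jmul_mid. Qed.

Lemma jract_conjM h z y :
  jmul E (jract E y h) (jract E (jlact E h^-1%g z) h) = jract E (jmul E y z) h.
Proof. by rewrite -jract_mul -jmul_mid -jlactM mulgV jlact1. Qed.

Lemma gactlM g k x : gactl (g * k)%g x = gactl g (gactl k x).
Proof.
rewrite /gactl gpartLM gpartJM jlactM; congr (jlact E _ _).
rewrite !jmulDl -!jmulA !jlactD !jlact_conjM !jmulDr !addrA.
by congr (_ + _); apply: addrAC.
Qed.

Lemma gactrM x g k : gactr x (g * k)%g = gactr (gactr x g) k.
Proof.
rewrite /gactr gpartLM gpartJM jractM !jmulDr jmulA !jract_conjM !jractD.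
by rewrite !jmulDl !addrA.
Qed.

Lemma gactC g x k : gactr (gactl g x) k = gactl g (gactr x k).
Proof.
rewrite /gactl /gactr !jactC -jlact_mul -!jlactD.
rewrite !jractD !jmulDl !jract_mul !jmulDr !jmulA.
by rewrite addrACA.
Qed.

End Bimodule.

(** * Orbits and stabilisers in the dual *)

Section Dual.
Variables (F : finFieldType) (J : finVectType F) (L : finGroupType).
Variable E : algGroupExt J L.
Local Notation G := (semidirect E).
Implicit Types (x y z : J) (h p : L) (a b g k : G) (lam mu : dual J).

(** The two-sided action a x b on J; on the dual, [dbiact lam a b] is
    b lam a, the functional x |-> lam (a x b). *)
Definition biact a x b : J := gactr (gactl a x) b.
Definition dbiact lam a b : dual J := dactr (dactl b lam) a.

Lemma biactD a b : {morph biact a ^~ b : x y / x + y}.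
Proof.
move=> x y; rewrite /biact (linmapD (gactl_linear a)).
exact: (linmapD (gactr_linear b)).
Qed.

Lemma biact0 a b : biact a 0 b = 0.
Proof.
by rewrite /biact (linmap0 (gactl_linear a)) (linmap0 (gactr_linear b)).
Qed.

Lemma biactN a b x : biact a (- x) b = - biact a x b.
Proof. by apply/eqP; rewrite -addr_eq0 -biactD addNr biact0. Qed.

Lemma biactB a b : {morph biact a ^~ b : x y / x - y}.
Proof. by move=> x y; rewrite biactD biactN. Qed.

Lemma biact1 x : biact 1%g x 1%g = x.
Proof. by rewrite /biact gactl1 gactr1. Qed.

Lemma biactM a b g k x : biact a (biact g x k) b = biact (a * g)%g x (k * b)%g.
Proof. by rewrite /biact gactlM gactrM !gactC. Qed.

Lemma biactK a b : cancel (biact a ^~ b) (biact a^-1%g ^~ b^-1%g).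
Proof. by move=> x; rewrite biactM mulVg mulgV biact1. Qed.

Lemma biactKV a b : cancel (biact a^-1%g ^~ b^-1%g) (biact a ^~ b).
Proof. by move=> x; rewrite biactM mulgV mulVg biact1. Qed.

Lemma biact_embL h p x :
  biact (embL E h) x (embL E p) = jract E (jlact E h x) p.
Proof. by rewrite /biact gactl_embL gactr_embL. Qed.

Lemma dbiactE lam a b x : dbiact lam a b x = lam (biact a x b).
Proof. by rewrite dactrE dactlE. Qed.

Lemma dbiactM lam a b g k :
  dbiact (dbiact lam a b) g k = dbiact lam (a * g)%g (k * b)%g.
Proof. by apply/lfunP=> x; rewrite !dbiactE biactM. Qed.

Lemma dbiact1 lam : dbiact lam 1%g 1%g = lam.
Proof. by apply/lfunP=> x; rewrite dbiactE biact1. Qed.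

Lemma dorbitP lam mu :
  reflect (exists a b, mu = dbiact lam a b) (mu \in dorbit E lam).
Proof.
apply: (iffP imsetP) => [[[b a] _ ->] | [a [b ->]]]; first by exists a, b.
by exists (b, a).
Qed.

Lemma dorbit_dbiact lam a b : dbiact lam a b \in dorbit E lam.
Proof. by apply/dorbitP; exists a, b. Qed.

Lemma dorbit_sym lam mu : mu \in dorbit E lam -> lam \in dorbit E mu.
Proof.
case/dorbitP=> a [b ->]; apply/dorbitP; exists a^-1%g, b^-1%g.
by rewrite dbiactM mulgV mulVg dbiact1.
Qed.

Lemma dstabE lam h :
  reflect (forall a b x,
             lam (biact a (jract E (jlact E h^-1%g x) h) b) = lam (biact a x b))
          (h \in dstab E lam).
Proof.
apply: (iffP (dstabP _ _ _)) => [lamh a b x | lamh _ /dorbitP[a [b ->]]].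
  by rewrite -!dbiactE -[in RHS](lamh _ (dorbit_dbiact lam a b)) coadE.
by apply/lfunP=> x; rewrite coadE !dbiactE.
Qed.

Lemma dstab_dbiact lam a b h :
  h \in dstab E lam -> h \in dstab E (dbiact lam a b).
Proof.
by move=> /dstabE lamh; apply/dstabE=> g k x; rewrite !dbiactE !biactM.
Qed.

Lemma embLV h : embL E h^-1%g = (embL E h)^-1%g.
Proof. by rewrite /embL morphV ?inE. Qed.

Lemma dstabJ lam h p : ((h ^ p)%g \in dstab E lam) = (h \in dstab E lam).
Proof.
suff imp (k q : L) : k \in dstab E lam -> (k ^ q)%g \in dstab E lam.
  by apply/idP/idP=> [/(imp _ p^-1%g)|/imp//]; rewrite conjgK.
move=> /dstabE lamk; apply/dstabE=> a b x.
have -> y : jract E (jlact E (k ^ q)^-1%g y) (k ^ q)%g =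
    biact (embL E q^-1%g) (jract E (jlact E k^-1%g
      (biact (embL E q) y (embL E q^-1%g))) k) (embL E q).
  by rewrite !biact_embL !jactC -!jractM -!jlactM /conjg !invMg invgK !mulgA.
rewrite biactM lamk !biactM -!mulgA.
by rewrite embLV mulVg mulg1 mulKg.
Qed.

Lemma dstab_normal lam : dstab E lam <| [set: L].
Proof.
apply/andP; split; first exact: subsetT.
apply/subsetP=> p _; rewrite inE; apply/subsetP=> h; rewrite mem_conjg => lamh.
by rewrite -(conjgKV p h) dstabJ.
Qed.

(** The functionals mu such that h fixes all of G mu G form a subspace: by
    [dstabE] they are the solutions of linear equations.  Hence the sum of spans
    that defines [fixdual] adds no new functional. *)
Lemma mem_fixdual h mu : (mu \in fixdual E h) = (h \in dstab E mu).
Proof.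
apply/idP/idP=> [mu_h | mu_h]; last first.
  rewrite memvE /fixdual; apply: subv_trans (sumv_sup mu _ (subvv _)) => //.
  by rewrite -memvE memv_span ?mem_enum ?dorbit_refl.
have P0 : h \in dstab E 0 by apply/dstabE=> a b x; rewrite !zero_lfunE.
have PD c u v :
    h \in dstab E u -> h \in dstab E v -> h \in dstab E (c *: u + v).
  move=> /dstabE Pu /dstabE Pv; apply/dstabE=> a b x.
  by rewrite !add_lfunE !scale_lfunE Pu Pv.
have Psum (I : finType) (Q : pred I) (f : I -> dual J) :
    (forall i, Q i -> h \in dstab E (f i)) ->
  h \in dstab E (\sum_(i | Q i) f i).
  move=> Pf; elim/big_rec: _ => // i v /Pf Pfi Pv.
  by rewrite -[f i]scale1r; apply: PD.
have [vs vs_in ->] := memv_sumP mu_h; apply: (Psum) => lam lam_h.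
have := vs_in _ lam_h; rewrite -[enum _]in_tupleE => /coord_span ->.
apply: Psum => i _; rewrite -[_ *: _]addr0; apply: PD => //.
have /dorbitP[a [b ->]] : (in_tuple (enum (dorbit E lam)))`_i \in dorbit E lam.
  by rewrite -mem_enum mem_nth.
exact: dstab_dbiact.
Qed.

Lemma JperpP h x :
  reflect (forall mu, h \in dstab E mu -> mu x = 0) (x \in Jperp E h).
Proof.
rewrite memvE /Jperp; apply: (iffP subv_bigcapP) => [Jx mu | Jx mu].
  by rewrite -mem_fixdual => /Jx; rewrite -memvE memv_ker => /eqP.
by rewrite mem_fixdual -memvE memv_ker => /Jx->.
Qed.

Lemma Jperp_biact h a b x : x \in Jperp E h -> biact a x b \in Jperp E h.
Proof.
move=> /JperpP Jx; apply/JperpP=> mu mu_h.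
by rewrite -dbiactE Jx ?dstab_dbiact.
Qed.

Lemma JperpJ h p : Jperp E (h ^ p)%g = Jperp E h.
Proof.
by apply/vspaceP=> x; apply/JperpP/JperpP=> Jx mu mu_h;
  apply: Jx; move: mu_h; rewrite dstabJ.
Qed.

End Dual.

(** * The values of the characters chi_alpha *)

Section CharacterValues.
Variables (F : finFieldType) (J : finVectType F) (L : finGroupType).
Variable E : algGroupExt J L.
Variables (eps : addChar F) (eps_nontrivial : exists t : F, eps t != 1).
Local Notation G := (semidirect E).
Implicit Types (x y z : J) (h p : L) (a b g k : G) (lam mu : dual J).

(** Let h = gpartL g.  Modulo the annihilator of G lam G, a two-sided ideal of J
    which is also stable under L, conjugation by h is the identity of J, so that
    h may be moved past every factor of k^-1 g k. *)
Lemma biact_conj lam a b g k : gpartL g \in dstab E lam ->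
  lam (biact a (gpartJ (g ^ k)) b)
    = lam (biact a (biact k^-1 (gpartJ g) k) b).
Proof.
move=> lam_g; have gk := conjgC g k; set g' := (g ^ k)%g in gk *.
have g'L : gpartL g' = (gpartL g ^ gpartL k)%g by rewrite /g' /conjg !gpartLM.
move: g' gk g'L => g' gk g'L; set l := gpartL k in g'L *; set x' := gpartJ g'.
pose x1 := jract E (jlact E l^-1 (gpartJ g)) l.
(* Compare the J-components of g k and k g': gpartJ k enters the second one
   through a conjugate by gpartL g', which mu does not tell from gpartJ k. *)
have key mu : gpartL g \in dstab E mu ->
    mu (x1 + jmul E x1 (gpartJ k)) = mu (x' + jmul E (gpartJ k) x').
  rewrite -(dstabJ _ _ _ l) -g'L => mu_g'.
  pose y' := jract E (jlact E (gpartL g')^-1 (gpartJ k)) (gpartL g').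
  have : mu (y' + jmul E y' x') = mu (gpartJ k + jmul E (gpartJ k) x').
    have /dstabE/(_ 1%g (sdpoint E 1 x') (gpartJ k)) := mu_g'.
    by rewrite /biact !gactl1 /gactr gpartL_sdpoint gpartJ_sdpoint !jract1.
  have := congr1 (fun u => mu (gpartJ u)) gk.
  rewrite /= !gpartJM -/y' -/x' -/x1 !linearD /= => e1 e2.
  apply: (addrI (mu (gpartJ k))).
  by rewrite addrA [_ + mu x1]addrC e1 addrAC e2 addrAC addrA.
have := key (dbiact lam (a * k^-1 * embL E l)%g b).
rewrite dstab_dbiact // => /(_ isT).
have -> : x1 + jmul E x1 (gpartJ k) = biact (embL E l^-1) (gpartJ g) k.
  by rewrite /biact gactl_embL.
have -> : x' + jmul E (gpartJ k) x' = biact (embL E l^-1 * k) x' 1.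
  by rewrite /biact gactlM gactl_embL gactr1 /gactl -jlactM mulVg jlact1.
by rewrite !dbiactE !biactM !embLV !mulgA !mulgK mulgKV mul1g => ->.
Qed.

(** For b = p (1 + y) in G, summing over y first leaves #|J| * eps (lam (x p))
    if x is in J_(lam,right) and 0 otherwise. *)
Lemma xi_sumE lam (theta : 'CF(dstab E lam)) g :
  (\sum_p xi eps theta p) g = theta (gpartL g) *
     (#|J|%:R^-1 * \sum_(b : G) eps (lam (gactr (gpartJ g) b))).
Proof.
rewrite sum_cfunE; set x := gpartJ g.
have [lam_g | lam'g] := boolP (gpartL g \in dstab E lam); last first.
  rewrite (cfun0 _ lam'g) mul0r big1 // => p _.
  by rewrite cfun0 //; apply: contra lam'g => /G0P[].
transitivity (theta (gpartL g) * \sum_(p : L) if x \in Jright E lam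
                then eps (lam (jract E x p)) else 0).
  rewrite mulr_sumr; apply: eq_bigr => p _; case: ifPn => [Jx | J'x].
    by rewrite xiE ?dactlE ?gactr_embL //; apply/G0P.
  by rewrite cfun0 ?mulr0 //; apply: contra J'x => /G0P[].
congr (_ * _); rewrite /gactr.
rewrite (sum_semidirect E (fun p y =>
  eps (lam (jract E x p + jmul E (jract E x p) y)))).
rewrite mulr_sumr; apply: eq_bigr => p _.
under eq_bigr do rewrite linearD addcharD.
rewrite -mulr_sumr (sum_addchar eps_nontrivial) => [|c u v]; last first.
  by rewrite jmul_linearr linearP.
suff -> : [forall y, lam (jmul E (jract E x p) y) == 0] = (x \in Jright E lam).
  case: ifP => _; last by rewrite !mulr0.
  by rewrite mulrCA mulVf ?mulr1 // pnatr_eq0 -lt0n; apply/card_gt0P; exists 0.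
apply/forallP/JrightP=> lam_x y; last by rewrite -jmul_mid lam_x.
have /eqP := lam_x (jlact E p^-1 y).
by rewrite -jmul_mid -jlactM mulgV jlact1.
Qed.

Definition orbit_sum lam x : algC :=
  \sum_(a : G) \sum_(b : G) eps (lam (biact a x b)).

(** Both sides vanish if gpartL g is not in H_(G lam G), a normal subgroup of L.
    Otherwise [biact_conj] turns the sum over conjugates into the sum over
    two-sided translates. *)
Lemma chiE (alpha : {lam : dual J & 'CF(dstab E lam)}) g :
    (forall h p, tagged alpha (h ^ p)%g = tagged alpha h) ->
  chi eps alpha g = (#|G0 E (tag alpha)|%:R * #|J|%:R)^-1 *
    (tagged alpha (gpartL g) * orbit_sum (tag alpha) (gpartJ g)).
Proof.
case: alpha => lam theta /= thetaJ; rewrite /chi cfIndE ?subsetT //=.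
rewrite invfM -mulrA; congr (_ * _).
have [lam_g | lam'g] := boolP (gpartL g \in dstab E lam); last first.
  rewrite (cfun0 _ lam'g) mul0r mulr0 big1 // => k _.
  by rewrite xi_sumE [gpartL _]gpartLM gpartLM thetaJ (cfun0 _ lam'g) mul0r.
have psiJ k : (\sum_p xi eps theta p) (g ^ k)%g = theta (gpartL g) *
    (#|J|%:R^-1 * \sum_(b : G) eps (lam (biact k^-1 (gpartJ g) b))).
  rewrite xi_sumE [gpartL (g ^ k)](_ : _ = (gpartL g ^ gpartL k)%g); last first.
    by rewrite /conjg !gpartLM.
  rewrite thetaJ; congr (_ * (_ * _)); rewrite [RHS](reindex_inj (mulgI k)) /=.
  apply: eq_bigr => b _; have := biact_conj 1 b k lam_g.
  by rewrite biactM mul1g {1}/biact gactl1 => ->.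
rewrite (eq_bigl predT) => [|k]; last exact: in_setT.
under eq_bigr do rewrite psiJ.
rewrite -mulr_sumr -mulr_sumr mulrCA; congr (_ * (_ * _)).
by rewrite /orbit_sum [RHS](reindex_inj invg_inj).
Qed.

(** If rG affords theta, then xi is afforded by rG twisted by the linear
    character eps \o (p lam) of G_(0,lam). *)
Lemma xi_char lam (theta : 'CF(dstab E lam)) p :
  theta \is a character -> xi eps theta p \is a character.
Proof.
case/char_reprP=> [[n rG] ->{theta}].
pose psi g := eps (dactl (embL E p) lam (gpartJ g)).
pose rho g := psi g *: rG (gpartL g).
have rhoP : mx_repr (G0 E lam) rho.
  split=> [|g k /G0P[Hg Jg] /G0P[Hk Jk]].
    by rewrite /rho /psi linear0 addchar0 scale1r repr_mx1.
  rewrite /rho gpartLM repr_mxM // -scalemxAl -scalemxAr scalerA -addcharD.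
  congr (eps _ *: _); rewrite gpartJM !linearD /=.
  have /JrightP Jz := Jright_conj Hk Jg.
  have /dstabP/(_ _ (dactl_dorbit E p lam)) muk := Hk.
  rewrite -coadE muk [X in _ + _ + X](_ : _ = 0) ?addr0 //.
  by rewrite dactlE gactr_embL jract_mul Jz.
suff -> : xi eps (cfRepr rG) p = cfRepr (MxRepresentation rhoP).
  exact: cfRepr_char.
apply/cfun_inP=> g G0g; have [Hg _] := G0P _ _ G0g.
by rewrite xiE // !cfunE G0g Hg /= !mulr1n /rho mxtraceZ mulrC.
Qed.

Lemma chi_char (alpha : {lam : dual J & 'CF(dstab E lam)}) :
  tagged alpha \is a character -> chi eps alpha \is a character.
Proof.
move=> theta_char; apply/cfInd_char/rpred_sum => p _; exact: xi_char.
Qed.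

End CharacterValues.

(** * Orbit sums *)

Section OrbitSums.
Variables (F : finFieldType) (J : finVectType F) (L : finGroupType).
Variable E : algGroupExt J L.
Variables (eps : addChar F) (eps_nontrivial : exists t : F, eps t != 1).
Local Notation G := (semidirect E).
Implicit Types (x y z : J) (h p : L) (a b g k : G) (lam mu : dual J).
Local Notation orbit_sum := (@orbit_sum F J L E eps).

Lemma orbit_sum_biact lam a b x :
  orbit_sum lam (biact a x b) = orbit_sum lam x.
Proof.
rewrite /orbit_sum [RHS](reindex_inj (mulIg a)) /=; apply: eq_bigr => g _.
rewrite [RHS](reindex_inj (mulgI b)) /=; apply: eq_bigr => k _.
by rewrite biactM.
Qed.

Lemma orbit_sum_Jperp lam h x z : h \in dstab E lam -> z \in Jperp E h ->
  orbit_sum lam (x + z) = orbit_sum lam x.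
Proof.
move=> lam_h /JperpP Jz; apply: eq_bigr => a _; apply: eq_bigr => b _.
by rewrite -!dbiactE linearD /= Jz ?dstab_dbiact ?addr0.
Qed.

Lemma orbit_sum_at0 lam : orbit_sum lam 0 != 0.
Proof.
rewrite /orbit_sum; under eq_bigr do under eq_bigr do
  rewrite biact0 linear0 addchar0.
rewrite !sumr_const -mulrnA pnatr_eq0 muln_eq0 orbb -lt0n.
by apply/card_gt0P; exists 1%g.
Qed.

Lemma conj_orbit_sum lam x :
  (orbit_sum lam x)^* = \sum_(a : G) \sum_(b : G) eps (- dbiact lam a b x).
Proof.
rewrite rmorph_sum; apply: eq_bigr => a _; rewrite rmorph_sum.
by apply: eq_bigr => b _; rewrite dbiactE; apply: conj_addchar.
Qed.

(** The sum expands into sums of additive characters attached to differences of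
    an element of G lam G and one of G mu G, none of which is 0. *)
Lemma orbit_sum_orthogonal lam mu : mu \notin dorbit E lam ->
  \sum_x orbit_sum lam x * (orbit_sum mu x)^* = 0.
Proof.
move=> lam'mu; under eq_bigr do rewrite conj_orbit_sum mulr_suml.
rewrite exchange_big big1 // => a _ /=; under eq_bigr do rewrite mulr_suml.
rewrite exchange_big big1 // => b _ /=; under eq_bigr do rewrite mulr_sumr.
rewrite exchange_big big1 // => c _ /=; under eq_bigr do rewrite mulr_sumr.
rewrite exchange_big big1 // => d _ /=.
rewrite (eq_bigr (fun x => eps ((dbiact lam a b - dbiact mu c d) x))) => [|x _].
  rewrite (sum_addchar_dual eps_nontrivial) subr_eq0; case: eqP => // eq_lm.
  case/negP: lam'mu; apply/dorbitP; exists (a * c^-1)%g, (d^-1 * b)%g.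
  by rewrite -dbiactM eq_lm dbiactM mulgV mulVg dbiact1.
by rewrite add_lfunE opp_lfunE -dbiactE addcharD.
Qed.

End OrbitSums.

(** * Superclasses *)

Section Superclasses.
Variables (F : finFieldType) (J : finVectType F) (L : finGroupType).
Variable E : algGroupExt J L.
Local Notation G := (semidirect E).
Implicit Types (x y z : J) (h p r : L) (a b g k : G) (lam mu : dual J).

Lemma mem_piJ h x : x \in piJ E h x.
Proof. by rewrite inE subrr mem0v. Qed.

Lemma eq_piJ h x y : (piJ E h x == piJ E h y) = (x - y \in Jperp E h).
Proof.
apply/eqP/idP=> [eq_xy | Jxy]; first by have := mem_piJ h x; rewrite eq_xy inE.
apply/setP=> z; rewrite !inE -{2}[z](subrK x) -[_ - y]addrA.
by rewrite [RHS]rpredDr.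
Qed.

Lemma piJ_biact h a b x :
  [set gactr (gactl a y) b | y in piJ E h x] = piJ E h (biact a x b).
Proof.
apply/setP=> z; rewrite inE; apply/imsetP/idP=> [[y] | Jz].
  by rewrite inE => Jy ->; rewrite -/(biact a y b) -biactB Jperp_biact.
exists (biact a^-1 z b^-1)%g; last by rewrite -/(biact _ _ _) biactKV.
by rewrite inE -[x](biactK a b) -biactB Jperp_biact.
Qed.

Lemma mem_qorbit h x y :
  reflect (exists a b, y - biact a x b \in Jperp E h)
          (piJ E h y \in qorbit E (piJ E h x)).
Proof.
apply: (iffP imsetP) => [[[a b] _ /= /eqP] | [a [b Jy]]].
  by rewrite piJ_biact eq_piJ; exists a, b.
by exists (a, b) => //=; apply/eqP; rewrite piJ_biact eq_piJ.
Qed.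

Lemma qorbit_eq h x y :
    piJ E h y \in qorbit E (piJ E h x) ->
  qorbit E (piJ E h y) = qorbit E (piJ E h x).
Proof.
case/imsetP=> [[a b] _ /=]; rewrite piJ_biact => ->.
apply/setP=> c; apply/imsetP/imsetP=> [[[g k] _ /=]|[[g k] _ /=]];
  rewrite piJ_biact => ->.
  by exists (g * a, b * k)%g => //=; rewrite piJ_biact biactM.
exists (g * a^-1, b^-1 * k)%g => //=.
by rewrite piJ_biact biactM mulgKV mulKVg.
Qed.

Lemma mem_Kset (beta : L * {set {set J}}) g : (g \in Kset E beta) =
  (gpartL g \in beta.1 ^: [set: L])%g && (piJ E beta.1 (gpartJ g) \in beta.2).
Proof.
apply/mulsgP/andP=> [[_ _ /imsetP[h hL ->] /imsetP[x xJ ->] ->] | [gL gJ]].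
  rewrite -/(sdpoint E h x) gpartL_sdpoint gpartJ_sdpoint.
  by split=> //; rewrite inE in xJ.
exists (embL E (gpartL g)) (sdpair1 (oneJ_gact E) (OneJ E (gpartJ g))).
- exact: imset_f.
- by apply: imset_f; rewrite inE.
by rewrite -[LHS]sdpointK.
Qed.

Variable R : {set L}.
Hypothesis R_repr : is_transversal R (classes [set: L]) [set: L].

(** A superclass is determined by any of its elements and by the chosen
    representative of its L-component. *)
Lemma KsetE beta g : beta \in calB E R -> g \in Kset E beta ->
  beta.2 = qorbit E (piJ E beta.1 (gpartJ g)).
Proof.
rewrite inE mem_Kset => /andP[_ /imsetP[c /imsetP[x _ ->] ->]] /andP[_].
by move/qorbit_eq.
Qed.

Lemma mem_calB r x : r \in R -> (r, qorbit E (piJ E r x)) \in calB E R.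
Proof. by move=> Rr; rewrite inE Rr /=; do 2!apply: imset_f. Qed.

Lemma mem_Kset_repr r h x : h \in (r ^: [set: L])%g ->
  sdpoint E h x \in Kset E (r, qorbit E (piJ E r x)).
Proof.
move=> rh; rewrite mem_Kset gpartL_sdpoint gpartJ_sdpoint rh /=.
by apply/mem_qorbit; exists 1%g, 1%g; rewrite biact1 subrr mem0v.
Qed.

Lemma class_repr h : exists2 r, r \in R & h \in (r ^: [set: L])%g.
Proof.
have hL : (h ^: [set: L])%g \in classes [set: L] by rewrite mem_classes ?inE.
exists (transversal_repr 1%g R (h ^: [set: L])%g).
  exact: repr_mem_transversal R_repr _ _ hL.
by rewrite class_sym; apply: repr_mem_pblock R_repr _ _ hL.
Qed.

Lemma class_repr_inj h : {in R &, forall r s,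
  h \in (r ^: [set: L])%g -> h \in (s ^: [set: L])%g -> r = s}.
Proof.
move=> r s Rr Rs rh sh; have [/and3P[_ tiL _] _ _] := and3P R_repr.
have rL q : (q ^: [set: L])%g \in classes [set: L] by rewrite mem_classes ?inE.
apply: (pblock_inj R_repr Rr Rs).
rewrite !(def_pblock tiL (rL _) (class_refl _ _)).
by rewrite -(class_eqP rh) -(class_eqP sh).
Qed.

Lemma Kset_inj g : {in calB E R &, forall beta gamma,
  g \in Kset E beta -> g \in Kset E gamma -> beta = gamma}.
Proof.
move=> beta gamma Bb Bc gb gc.
have := KsetE Bb gb; have := KsetE Bc gc.
move: gb gc; rewrite !mem_Kset => /andP[gb _] /andP[gc _].
move: Bb Bc; rewrite !inE => /andP[Rb _] /andP[Rc _].
have := class_repr_inj Rb Rc gb gc; case: beta gamma {Rb Rc gb gc} => r u [s v].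
by move=> /= -> -> ->.
Qed.

Lemma Kset_cover g : exists2 beta, beta \in calB E R & g \in Kset E beta.
Proof.
have [r Rr rg] := class_repr (gpartL g).
exists (r, qorbit E (piJ E r (gpartJ g))); first exact: mem_calB.
by rewrite -{1}[g]sdpointK mem_Kset_repr.
Qed.

Lemma Kset_nonempty beta : beta \in calB E R -> exists g, g \in Kset E beta.
Proof.
case: beta => r u; rewrite inE /= => /andP[Rr /imsetP[_ /imsetP[x _ ->] ->]].
by exists (sdpoint E r x); apply: mem_Kset_repr; apply: class_refl.
Qed.

Lemma Kset_uniq : uniq [seq Kset E beta | beta <- enum (calB E R)].
Proof.
rewrite map_inj_in_uniq ?enum_uniq // => beta gamma; rewrite !mem_enum.
move=> Bb Bc eq_bc; have [g gb] := Kset_nonempty Bb.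
by apply: (Kset_inj Bb Bc gb); rewrite -eq_bc.
Qed.

Lemma Kset_partition :
  partition [set:: [seq Kset E beta | beta <- enum (calB E R)]] [set: G].
Proof.
apply/and3P; split.
- rewrite eqEsubset subsetT; apply/subsetP=> g _.
  have [beta Bb gb] := Kset_cover g; apply/bigcupP; exists (Kset E beta) => //.
  by rewrite inE; apply/map_f; rewrite mem_enum.
- apply/trivIsetP=> A B; rewrite !inE => /mapP[beta + ->] /mapP[gamma + ->].
  rewrite !mem_enum => Bb Bc; apply: contraNT => /pred0Pn[g /andP[/= gb gc]].
  by rewrite (Kset_inj Bb Bc gb gc).
rewrite inE; apply/negP=> /mapP[beta]; rewrite mem_enum => Bb K0.
by have [g] := Kset_nonempty Bb; rewrite -K0 inE.
Qed.

(** For h = 1 the ideal J_h is 0, since 1 fixes every functional. *)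
Lemma Kset1 : [set 1%g] \in [seq Kset E beta | beta <- enum (calB E R)].
Proof.
have [r Rr] := class_repr 1; case/imsetP=> p _ /eqP; rewrite eq_sym -(conj1g p).
rewrite (inj_eq (conjg_inj p)) => /eqP r1; rewrite {r}r1 in Rr.
have J10 x : (x \in Jperp E 1%g) = (x == 0).
  apply/JperpP/eqP=> [x0 | -> mu _]; last exact: linear0.
  by apply: dual_separates => mu; rewrite x0 ?group1.
apply/mapP; exists (1%g, qorbit E (piJ E 1%g 0)).
  by rewrite mem_enum mem_calB.
apply/setP=> g; rewrite mem_Kset inE /= class1G inE.
apply/eqP/andP=> [-> | [/eqP g1 /mem_qorbit[a [b]]]].
  split=> //; apply/mem_qorbit; exists 1%g, 1%g; rewrite biact1 J10 subr0.
  by [].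
rewrite biact0 subr0 J10 => /eqP gJ0; rewrite -[g]sdpointK g1 gJ0.
by rewrite -[RHS]sdpointK.
Qed.

End Superclasses.

(** * Orthogonality and completeness *)

Section Supercharacters.
Variables (F : finFieldType) (J : finVectType F) (L : finGroupType).
Variable E : algGroupExt J L.
Variables (eps : addChar F) (eps_nontrivial : exists t : F, eps t != 1).
Local Notation G := (semidirect E).
Implicit Types (x y z : J) (h p r : L) (a b g k : G) (lam mu : dual J).

Variable Lam : {set dual J}.
Hypothesis Lam_repr : is_transversal Lam [set dorbit E lam | lam : dual J]
  [set: dual J].
Variable R : {set L}.
Hypothesis R_repr : is_transversal R (classes [set: L]) [set: L].

Local Notation index := {lam : dual J & 'CF(dstab E lam)}.
Implicit Type alpha : index.

Lemma calAP alpha :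
  reflect (tag alpha \in Lam /\
           tagged alpha \in relative_irr [set: L]%G (dstab E (tag alpha)))
          (alpha \in calA E Lam).
Proof.
apply: (iffP allpairsPdep) => [[lam [theta [Lam_lam irr_theta ->]]] | []].
  by rewrite mem_enum in Lam_lam.
case: alpha => lam theta /= Lam_lam irr_theta; exists lam, theta.
by rewrite mem_enum.
Qed.

Lemma calA_uniq : uniq (calA E Lam).
Proof.
apply: allpairs_uniq_dep => [|lam _|[lam theta] [mu eta] _ _ //].
  exact: enum_uniq.
exact: undup_uniq.
Qed.

Lemma calA_invariant alpha h p : alpha \in calA E Lam ->
  tagged alpha (h ^ p)%g = tagged alpha h.
Proof.
case/calAP=> _ irr_theta.
by apply: (relative_irrJ (dstab_normal E _)); rewrite ?inE.
Qed.

Lemma dorbit_repr mu : exists2 lam, lam \in Lam & mu \in dorbit E lam.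
Proof.
have mu_orb : dorbit E mu \in [set dorbit E lam | lam : dual J].
  exact: imset_f.
exists (transversal_repr 0 Lam (dorbit E mu)).
  exact: repr_mem_transversal Lam_repr _ _ mu_orb.
by apply/dorbit_sym; apply: repr_mem_pblock Lam_repr _ _ mu_orb.
Qed.

Lemma dorbit_repr_inj :
  {in Lam &, forall lam mu, mu \in dorbit E lam -> mu = lam}.
Proof.
move=> lam mu Llam Lmu lam_mu; have [/and3P[_ tiL _] _ _] := and3P Lam_repr.
have orb nu : dorbit E nu \in [set dorbit E lam | lam : dual J].
  exact: imset_f.
apply: (pblock_inj Lam_repr Lmu Llam).
rewrite (def_pblock tiL (orb lam) lam_mu).
by rewrite (def_pblock tiL (orb lam) (dorbit_refl _ _)).
Qed.

Lemma chi_cfdot alpha beta : alpha \in calA E Lam -> beta \in calA E Lam ->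
  exists c, '[chi eps alpha, chi eps beta] = c *
    ((\sum_h tagged alpha h * (tagged beta h)^*) *
     (\sum_x orbit_sum E eps (tag alpha) x * (orbit_sum E eps (tag beta) x)^*)).
Proof.
move=> Aa Ab; rewrite cfdotE (eq_bigl predT) => [|g]; last exact: in_setT.
pose n (gam : index) : algC := (#|G0 E (tag gam)|%:R * #|J|%:R)^-1.
exists (#|[set: G]|%:R^-1 * (n alpha * (n beta)^*)).
rewrite -[RHS]mulrA; congr (_ * _).
rewrite mulr_suml mulr_sumr.
under [RHS]eq_bigr do rewrite mulr_sumr mulr_sumr.
rewrite -(sum_semidirect E (fun h x => n alpha * (n beta)^* *
  (tagged alpha h * (tagged beta h)^* *
  (orbit_sum E eps (tag alpha) x * (orbit_sum E eps (tag beta) x)^*)))).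
apply: eq_bigr => g _.
rewrite !(chiE eps_nontrivial); try by move=> h p; apply: calA_invariant.
by rewrite !rmorphM /= mulrACA; congr (_ * _); rewrite mulrACA.
Qed.

(** If the orbits differ, the orbit sums are orthogonal; if they coincide, the
    representatives are equal and the L-irreducible characters differ. *)
Lemma chi_orthogonal : {in calA E Lam &, forall alpha beta,
  alpha != beta -> '[chi eps alpha, chi eps beta] = 0}.
Proof.
move=> alpha beta Aa Ab neq_ab; have [c ->] := chi_cfdot Aa Ab.
have [[La irra] [Lb irrb]] := (calAP _ Aa, calAP _ Ab).
have [ab | ab] := boolP (tag beta \in dorbit E (tag alpha)); last first.
  by rewrite (orbit_sum_orthogonal eps_nontrivial) // !mulr0.
have /esym eq_ab := dorbit_repr_inj La Lb ab.
case: alpha beta eq_ab {Aa Ab La Lb ab} neq_ab irra irrb.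
move=> [lam theta] [mu eta] /= eq_lm; case: mu / eq_lm eta => eta.
rewrite eq_Tagged /= => neq irra irrb.
suff -> : \sum_h theta h * (eta h)^* = 0 by rewrite mul0r mulr0.
have /eqP := relative_irr_orthogonal (dstab_normal E _) irra irrb neq.
rewrite cfdotE mulf_eq0 invr_eq0 (negPf (neq0CG _)) /= big_mkcond /= => /eqP.
apply: etrans; apply: eq_bigr => h _.
by case: ifPn => // lam'h; rewrite cfun0 ?mul0r.
Qed.

Lemma chi_neq0 alpha : alpha \in calA E Lam -> chi eps alpha != 0.
Proof.
move=> Aa; have [_ irra] := calAP _ Aa.
apply/eqP=> /(congr1 (fun phi : 'CF([set: G]) => phi 1%g)); rewrite cfunE.
rewrite (chiE eps_nontrivial) => [|h p]; last exact: calA_invariant.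
have -> : gpartL (1%g : G) = 1%g by [].
have -> : gpartJ (1%g : G) = 0 by [].
move/eqP; rewrite !mulf_eq0 invr_eq0 mulf_eq0 (negPf (neq0CG _)) pnatr_eq0.
rewrite (negPf (orbit_sum_at0 _ _ _)).
rewrite (negPf (relative_irr1_neq0 (dstab_normal E _) irra)) !orbF /=.
by move/eqP/card0_eq/(_ 0).
Qed.

Lemma chi_pairwise_orthogonal :
  pairwise_orthogonal [seq chi eps alpha | alpha <- calA E Lam].
Proof.
apply/pairwise_orthogonalP.
split=> [|_ _ /mapP[alpha Aa ->] /mapP[beta Ab ->] neq].
  rewrite /= map_inj_in_uniq ?calA_uniq ?andbT => [|alpha beta Aa Ab eq_ab].
    by apply/mapP=> [[alpha /chi_neq0/eqP neq0 /esym]].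
  apply/eqP; apply: contraTT (chi_neq0 Aa) => /(chi_orthogonal Aa Ab)/eqP.
  by rewrite -eq_ab cfnorm_eq0 negbK.
by apply: chi_orthogonal => //; apply: contraNneq neq => ->.
Qed.

Lemma chi_superclass : {in [seq chi eps alpha | alpha <- calA E Lam]
    & [seq Kset E beta | beta <- enum (calB E R)],
  forall (phi : 'CF([set: G])) (A : {set G}),
    {in A &, forall g k, phi g = phi k}}.
Proof.
move=> _ _ /mapP[alpha Aa ->] /mapP[beta + ->].
rewrite mem_enum => Bb g k gb kb.
rewrite !(chiE eps_nontrivial); try by move=> h p; apply: calA_invariant.
congr (_ * _).
have := KsetE Bb gb; move: gb kb; rewrite !mem_Kset.
set r := beta.1 => /andP[/imsetP[p _ gL] _] /andP[/imsetP[q _ kL] kJ] eq_b.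
rewrite gL kL !calA_invariant //.
have [r_a | r'a] := boolP (r \in dstab E (tag alpha)); last first.
  by rewrite (cfun0 _ r'a) !mul0r.
move: kJ; rewrite eq_b => /mem_qorbit[a [b Jz]]; congr (_ * _).
rewrite -[gpartJ k](subrKC (biact a (gpartJ g) b)).
by rewrite (orbit_sum_Jperp _ _ r_a Jz) orbit_sum_biact.
Qed.

(** A function f constant on superclasses is L-invariant in h, and
    G x G-invariant and J_h-periodic in x; its partial Fourier transform [fhat]
    inherits the first two properties, and the third bounds its support. *)
Section Completeness.
Variable f : G -> algC.
Hypothesis f_superclass :
  {in [seq Kset E beta | beta <- enum (calB E R)],
     forall A : {set G}, {in A &, forall g k, f g = f k}}.

Let f_Kset beta g k : beta \in calB E R ->
  g \in Kset E beta -> k \in Kset E beta -> f g = f k.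
Proof. by move=> Bb; apply: f_superclass; apply: map_f; rewrite mem_enum. Qed.

Let fJ h p x : f (sdpoint E (h ^ p)%g x) = f (sdpoint E h x).
Proof.
have [r Rr rh] := class_repr R_repr h.
apply: (f_Kset (mem_calB E x Rr)).
  by apply: mem_Kset_repr; rewrite -(class_eqP rh) memJ_class ?inE.
exact: mem_Kset_repr.
Qed.

Let f_biact h a b x z : z \in Jperp E h ->
  f (sdpoint E h (biact a x b + z)) = f (sdpoint E h x).
Proof.
have [r Rr rh] := class_repr R_repr h.
have [p _ ->] := imsetP rh; rewrite JperpJ => Jz; rewrite !fJ.
apply: (f_Kset (mem_calB E x Rr)).
  rewrite mem_Kset gpartL_sdpoint gpartJ_sdpoint class_refl /=.
  by apply/mem_qorbit; exists a, b; rewrite addrC addKr.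
by apply: mem_Kset_repr; apply: class_refl.
Qed.

Definition fhat h mu := \sum_x f (sdpoint E h x) * eps (- mu x).

Let fhatJ h p mu : fhat (h ^ p)%g mu = fhat h mu.
Proof. by apply: eq_bigr => x _; rewrite fJ. Qed.

Let fhat_dbiact h mu a b : fhat h (dbiact mu a b) = fhat h mu.
Proof.
rewrite /fhat [RHS](reindex_inj (can_inj (biactK a b))) /=.
apply: eq_bigr => x _; rewrite dbiactE; congr (_ * _).
by rewrite -[biact a x b]addr0 f_biact ?mem0v.
Qed.

(** Averaging over translations by J_h leaves fhat unchanged by periodicity, but
    it produces the factor sum over w in J_h of eps (- mu w), which is 0 as mu
    is not trivial on J_h. *)
Let fhat_outside h mu : h \notin dstab E mu -> fhat h mu = 0.
Proof.
move=> mu'h.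
have [z Jz mu_z] : exists2 z, z \in Jperp E h & mu z != 0.
  apply/exists_inP; apply: contraNT mu'h => /exists_inPn mu0.
  rewrite -mem_fixdual; apply: (mem_double_annihilator eps_nontrivial) => x x0.
  apply/eqP/negPn/mu0/JperpP => nu nu_h; apply: x0.
  by rewrite mem_fixdual.
have sum0 : \sum_(w in Jperp E h) eps (- mu w) = 0.
  rewrite (@sum_addchar_linear _ _ eps_nontrivial _ _ (fun w => - mu w))
    => [|c u v].
    by case: ifPn => // /forall_inP/(_ z Jz); rewrite oppr_eq0 (negPf mu_z).
  by rewrite linearP opprD -scalerN.
have /eqP : #|[pred w in Jperp E h]|%:R * fhat h mu = 0.
  rewrite mulr_natl -sumr_const.
  transitivity (\sum_(w in Jperp E h) eps (- mu w) * fhat h mu); last first.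
    by rewrite -mulr_suml sum0 mul0r.
  apply: eq_bigr => w Jw; rewrite {1}/fhat (reindex_inj (addIr w)) mulr_sumr.
  apply: eq_bigr => x _; rewrite -{1}[x](biact1 E) f_biact // mulrCA -addcharD.
  by rewrite linearD opprD addrC.
rewrite mulf_eq0 pnatr_eq0 => /orP[/eqP/card0_eq/(_ 0)|/eqP//].
by rewrite !inE mem0v.
Qed.

Hypothesis f_chi : {in [seq chi eps alpha | alpha <- calA E Lam],
  forall phi : 'CF([set: G]), \sum_(g in [set: G]) f g * (phi g)^* = 0}.

(** As f is G x G-invariant, its scalar product with chi_alpha is, up to a
    nonzero factor, the scalar product on H_(G lam G) of h |-> fhat h lam with
    theta. *)
Let fhat_repr lam h : lam \in Lam -> h \in dstab E lam -> fhat h lam = 0.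
Proof.
move=> Llam; apply: (relative_irr_complete (dstab_normal E lam)
  (f := fun h => fhat h lam)) => [p k _ _ | theta irr_theta].
  exact: fhatJ.
pose alpha : index := Tagged (fun lam => 'CF(dstab E lam)) theta.
have Aa : alpha \in calA E Lam by apply/calAP.
have := f_chi (map_f _ Aa).
rewrite (eq_bigl predT) => [|g]; last exact: in_setT.
pose c : algC := (#|G0 E lam|%:R * #|J|%:R)^-1.
pose T h x := f (sdpoint E h x) * (c * (theta h * orbit_sum E eps lam x))^*.
rewrite (eq_bigr (fun g => T (gpartL g) (gpartJ g))) => [|g _]; last first.
  rewrite /T sdpointK (chiE eps_nontrivial) // => k p.
  exact: (calA_invariant k p Aa).
rewrite sum_semidirect.
have f_orbit_sum (k : L) : \sum_x f (sdpoint E k x) * (orbit_sum E eps lam x)^*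
    = (#|{: G}| ^ 2)%:R * fhat k lam.
  under eq_bigr do rewrite conj_orbit_sum mulr_sumr.
  rewrite exchange_big (eq_bigr (fun=> #|{: G}|%:R * fhat k lam)) => [|a _].
    by rewrite sumr_const -[LHS]mulr_natl mulrA natrM.
  under eq_bigr do rewrite mulr_sumr.
  rewrite exchange_big (eq_bigr (fun=> fhat k lam)) => [|b _].
    by rewrite sumr_const -[LHS]mulr_natl.
  exact: fhat_dbiact.
have Tsum (k : L) : \sum_x T k x
    = (c^* * (#|{: G}| ^ 2)%:R) * (fhat k lam * (theta k)^*).
  rewrite -mulrA [(#|_| ^ 2)%:R * _]mulrA -f_orbit_sum mulr_suml mulr_sumr.
  apply: eq_bigr => x _; rewrite /T !rmorphM /= mulrCA; congr (_ * _).
  by rewrite [(theta k)^* * _]mulrC mulrA.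
under eq_bigr do rewrite Tsum.
rewrite -mulr_sumr => /eqP; rewrite mulf_eq0 => /orP[|/eqP theta0].
  rewrite mulf_eq0 conjC_eq0 invr_eq0 mulf_eq0 (negPf (neq0CG _)) !pnatr_eq0 /=.
  by rewrite expn_eq0 andbT => /orP[/eqP/card0_eq/(_ 0)|/eqP/card0_eq/(_ 1%g)].
rewrite big_mkcond /= -[RHS]theta0; apply: eq_bigr => k _.
by case: ifPn => // lam'k; rewrite (cfun0 _ lam'k) conjC0 mulr0.
Qed.

Lemma superclass_function_eq0 : {in [set: G], forall g, f g = 0}.
Proof.
move=> g _; rewrite -[g]sdpointK.
apply: (fourier_inj eps_nontrivial (f := fun x => f (sdpoint E (gpartL g) x))).
move=> mu; rewrite -/(fhat (gpartL g) mu).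
have [mu_g | /fhat_outside//] := boolP (gpartL g \in dstab E mu).
have [lam Llam lam_mu] := dorbit_repr mu.
have /dorbitP[a [b mu_eq]] := lam_mu.
have /dorbitP[c [d lam_eq]] := dorbit_sym lam_mu.
by rewrite mu_eq fhat_dbiact fhat_repr // lam_eq dstab_dbiact.
Qed.

End Completeness.
End Supercharacters.

Theorem theorem3p3 (F : finFieldType) (J : finVectType F) (L : finGroupType)
    (E : algGroupExt J L)
    (eps : addChar F) (eps_nontrivial : exists t : F, eps t != 1)
    (Lam : {set dual J})
    (Lam_repr : is_transversal Lam [set dorbit E lam | lam : dual J]
                  [set: dual J])
    (R : {set L})
    (R_repr : is_transversal R (classes [set: L]) [set: L]) :
  @supercharacter_theory (semidirect E) [set: semidirect E]%G
    [seq chi eps alpha | alpha <- calA E Lam]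
    [seq Kset E beta | beta <- enum (calB E R)].
Proof.
have oS := chi_pairwise_orthogonal eps_nontrivial Lam_repr.
have uK := Kset_uniq E R_repr; have partK := Kset_partition E R_repr.
have SK := @chi_superclass _ _ _ E eps eps_nontrivial Lam R.
split=> //; last exact: Kset1.
  split=> // _ /mapP[alpha /calAP[_ irr_alpha] ->].
  by apply/chi_char/(relative_irr_char (dstab_normal E _) irr_alpha).
apply: (size_complete oS uK partK SK) => f fK fS.
exact: (superclass_function_eq0 eps_nontrivial Lam_repr R_repr fK fS).
Qed.
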